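(* Let $R^{*}\in\mathbb{R}^{m_T\times m_S}$ be a target block, let $B=R^{*}[\tau(P),\sigma(P)]$, $B_a=\tfrac12(B-B^{T})$, $B_s=\tfrac12(B+B^{T})$, and let $\lambda_1,\dots,\lambda_p$ be the eigenvalues of $B_s$. For every passive network, whatever its size and topology, and every admissible stiffness vector $k$, $$\bigl\|R(k)-R^{*}\bigr\|_F\;\ge\;\operatorname{dist}_F\bigl(R^{*},\mathcal{S}^{+}_P\bigr)\;=\;\Bigl(\tfrac14\bigl\|B-B^{T}\bigr\|_F^{2}+\sum_{i}\min(\lambda_i,0)^2\Bigr)^{1/2}.$$ The two terms are orthogonal (they are the squared Frobenius norms of $B_a$ and of the negative-semidefinite part of $B_s$, which are Frobenius-orthogonal). The second term vanishes exactly when $B_s\succeq0$, in which case the bound reduces to $\tfrac12\|B-B^{T}\|_F$; otherwise the bound is strictly larger than $\tfrac12\|B-B^{T}\|_F$.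
   Context: Network: $N$ point nodes at positions $x_i\in\mathbb{R}^2$ are joined by $n_b$ bonds. For a bond $b=(i,j)$ of length $L_b=|x_j-x_i|>0$ let $\hat n_b=(x_j-x_i)/L_b$; $q_b\in\mathbb{R}^{2N}$ carries $-\hat n_b$ at node $i$, $+\hat n_b$ at node $j$ and zeros elsewhere. The network is passive: $K=\sum_bk_bq_bq_b^{T}$ with stiffnesses $k_b>0$ (no odd couplings) and, after pinning three degrees of freedom to remove the planar rigid-body modes, the restriction $K_{ff}$ of $K$ to the remaining $n_{\mathrm{free}}=2N-3$ free degrees of freedom is positive definite. $C=K_{ff}^{-1}$. A stiffness vector is admissible if all $k_b>0$ and $K_{ff}$ is invertible. Response block: $S$ (driven) and $T$ (read) are sets of free degrees of freedom, $|S|=m_S$, $|T|=m_T$, $P=T\cap S$, $p=|P|$, $R(k)=C[T,S]\in\mathbb{R}^{m_T\times m_S}$. The injections $\tau:P\to\{1,\dots,m_T\}$ and $\sigma:P\to\{1,\dots,m_S\}$ give the position of each element of $P$ inside $T$ and inside $S$; $A[\tau(P),\sigma(P)]$ is the $p\times p$ submatrix with rows and columns indexed by $P$ in one common order. $\mathcal{S}^{+}_P=\{A\in\mathbb{R}^{m_T\times m_S}: A[\tau(P),\sigma(P)]\text{ is symmetric positive semidefinite}\}$. $\operatorname{dist}_F$ is distance in the Frobenius norm. *)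

(* Defs.v *)
From HB Require Import structures.
From mathcomp Require Import all_boot all_order all_algebra.
From mathcomp Require Import classical_sets reals.

Set Implicit Arguments.
Unset Strict Implicit.
Unset Printing Implicit Defensive.

Import Order.TTheory GRing.Theory Num.Theory.
Local Open Scope ring_scope.

(* The norm that the libraries put on matrices is the max norm. On row vectors
   [frob_norm] is the Euclidean norm. *)
Definition frob_dot (R : realType) (m n : nat) (A B : 'M[R]_(m, n)) : R :=
  \sum_i \sum_j A i j * B i j.

Definition frob_norm (R : realType) (m n : nat) (A : 'M[R]_(m, n)) : R :=
  Num.sqrt (\sum_i \sum_j A i j ^+ 2).

(* Meaningful for nonempty [E]: [inf] is [0] on the empty set. *)
Definition frob_dist (R : realType) (m n : nat) (A : 'M[R]_(m, n))
    (E : set 'M[R]_(m, n)) : R :=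
  inf [set frob_norm (A - X) | X in E]%classic.

Definition posdef (R : realType) (n : nat) (A : 'M[R]_n) : Prop :=
  A^T = A /\ forall v : 'cV[R]_n, v != 0 -> 0 < (v^T *m A *m v) 0 0.

Definition possemidef (R : realType) (n : nat) (A : 'M[R]_n) : Prop :=
  A^T = A /\ forall v : 'cV[R]_n, 0 <= (v^T *m A *m v) 0 0.

(* Eigenvalues listed with multiplicity. *)
Definition eigenvalues_of (R : realType) (n : nat) (A : 'M[R]_n)
    (lambda : 'I_n -> R) : Prop :=
  char_poly A = \prod_(i < n) ('X - (lambda i)%:P).

(* [N] is the sum of min(d_i, 0) v_i^T v_i over an orthonormal eigenbasis (v_i)
   of [A], the rows of [V], with eigenvalues d_i. *)
Definition negative_part (R : realType) (n : nat) (A N : 'M[R]_n) : Prop :=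
  exists (V : 'M[R]_n) (d : 'rV[R]_n),
    [/\ V *m V^T = 1%:M,
        A = V^T *m diag_mx d *m V
      & N = V^T *m diag_mx (map_mx (fun x => Num.min x 0) d) *m V].

(* Several bonds may join the same two nodes. The degrees of freedom of R^(2N)
   are indexed by 'I_(N * 2): coordinate c of node a is [mxvec_index a c]. *)
Record network (R : realType) := Network {
  nnodes : nat;
  pos : 'I_nnodes -> 'rV[R]_2;
  nbonds : nat;
  bond_src : 'I_nbonds -> 'I_nnodes;
  bond_tgt : 'I_nbonds -> 'I_nnodes;
  bond_length_gt0 : forall b, 0 < frob_norm (pos (bond_tgt b) - pos (bond_src b));
  pinned : {set 'I_(nnodes * 2)};
  card_pinned : #|pinned| = 3
}.

Section Network.
Variables (R : realType) (G : network R).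

Definition bond_length (b : 'I_(nbonds G)) : R :=
  frob_norm (pos (bond_tgt b) - pos (bond_src b)).

Definition bond_dir (b : 'I_(nbonds G)) : 'rV[R]_2 :=
  (bond_length b)^-1 *: (pos (bond_tgt b) - pos (bond_src b)).

Definition bond_vec (b : 'I_(nbonds G)) : 'cV[R]_(nnodes G * 2) :=
  (mxvec (\matrix_(a < nnodes G, c < 2)
     (if a == bond_src b then - bond_dir b 0 c
      else if a == bond_tgt b then bond_dir b 0 c else 0)))^T.

Definition stiffness_mx (k : 'I_(nbonds G) -> R) : 'M[R]_(nnodes G * 2) :=
  \sum_b k b *: (bond_vec b *m (bond_vec b)^T).

Definition nfree : nat := #|~: pinned G|.

Definition free_dof (i : 'I_nfree) : 'I_(nnodes G * 2) := enum_val i.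

Definition free_stiffness (k : 'I_(nbonds G) -> R) : 'M[R]_nfree :=
  mxsub free_dof free_dof (stiffness_mx k).

Definition compliance (k : 'I_(nbonds G) -> R) : 'M[R]_nfree :=
  invmx (free_stiffness k).

Definition passive : Prop :=
  exists k : 'I_(nbonds G) -> R,
    (forall b, 0 < k b) /\ posdef (free_stiffness k).

Definition admissible (k : 'I_(nbonds G) -> R) : Prop :=
  (forall b, 0 < k b) /\ free_stiffness k \in unitmx.

(* [t] and [s] enumerate T and S. *)
Definition response (mT mS : nat) (t : 'I_mT -> 'I_nfree)
    (s : 'I_mS -> 'I_nfree) (k : 'I_(nbonds G) -> R) : 'M[R]_(mT, mS) :=
  mxsub t s (compliance k).

(* The elements of P = T :&: S are t (tau a) = s (sigma a), a < p. *)
Definition overlap (mT mS p : nat) (tau : 'I_p -> 'I_mT)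
    (sigma : 'I_p -> 'I_mS) (t : 'I_mT -> 'I_nfree) (s : 'I_mS -> 'I_nfree)
    : Prop :=
  (forall a, t (tau a) = s (sigma a)) /\
  (fun a => t (tau a)) @: [set: 'I_p]
    = (t @: [set: 'I_mT]) :&: (s @: [set: 'I_mS]).

End Network.

Definition psd_overlap (R : realType) (mT mS p : nat) (tau : 'I_p -> 'I_mT)
    (sigma : 'I_p -> 'I_mS) : set 'M[R]_(mT, mS) :=
  [set A | possemidef (mxsub tau sigma A)]%classic.

(* Main.v *)
Require Import Defs.
From HB Require Import structures.
From mathcomp Require Import all_boot all_order all_algebra.
From mathcomp Require Import classical_sets reals ring.

Set Implicit Arguments.
Unset Strict Implicit.
Unset Printing Implicit Defensive.

Import Order.TTheory GRing.Theory Num.Theory.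
Local Open Scope ring_scope.


(* The compliance inherits positive semidefiniteness from the stiffness matrix,
   and so does its principal submatrix on P; hence every response block lies in
   the set whose distance is taken. That distance is computed by compressing to
   the P x P block: a symmetric Y is orthogonal to the antisymmetric part of B,
   and in an orthonormal eigenbasis of B_s the diagonal entries of Y are
   nonnegative, so each negative eigenvalue contributes at least its square.
   Equality holds when Y is the positive part of B_s. *)

(** * Frobenius inner product, isometries and submatrices *)

Section Frobenius.
Variable R : realType.

Lemma frob_dotE m n (A B : 'M[R]_(m, n)) : frob_dot A B = \tr (A *m B^T).
Proof.
apply: eq_bigr => i _; rewrite mxE; apply: eq_bigr => j _.
by rewrite !mxE.
Qed.

Lemma frob_dotC m n (A B : 'M[R]_(m, n)) : frob_dot A B = frob_dot B A.
Proof. by apply: eq_bigr => i _; apply: eq_bigr => j _; rewrite mulrC. Qed.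

Lemma frob_dotDl m n (A B C : 'M[R]_(m, n)) :
  frob_dot (A + B) C = frob_dot A C + frob_dot B C.
Proof. by rewrite !frob_dotE mulmxDl mxtraceD. Qed.

Lemma frob_dotZl m n a (A B : 'M[R]_(m, n)) :
  frob_dot (a *: A) B = a * frob_dot A B.
Proof. by rewrite !frob_dotE -scalemxAl mxtraceZ. Qed.

Lemma frob_dotDD m n (A B : 'M[R]_(m, n)) :
  frob_dot (A + B) (A + B) = frob_dot A A + 2 * frob_dot A B + frob_dot B B.
Proof.
rewrite !frob_dotDl ![frob_dot _ (A + B)]frob_dotC !frob_dotDl.
by rewrite [frob_dot B A]frob_dotC mulrDl mul1r !addrA.
Qed.

Lemma frob_dot_ge0 m n (A : 'M[R]_(m, n)) : 0 <= frob_dot A A.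
Proof.
by apply: sumr_ge0 => i _; apply: sumr_ge0 => j _; rewrite -expr2 sqr_ge0.
Qed.

Lemma frob_dot_eq0 m n (A : 'M[R]_(m, n)) : frob_dot A A = 0 -> A = 0.
Proof.
move=> /eqP; rewrite psumr_eq0 => [/allP A0|i _]; last first.
  by apply: sumr_ge0 => j _; rewrite -expr2 sqr_ge0.
apply/matrixP => i j; have := A0 i (mem_index_enum i).
rewrite psumr_eq0 => [/allP/(_ j (mem_index_enum j))|k _].
  by rewrite /= -expr2 sqrf_eq0 mxE => /eqP.
by rewrite -expr2 sqr_ge0.
Qed.

Lemma frob_normE m n (A : 'M[R]_(m, n)) : frob_norm A = Num.sqrt (frob_dot A A).
Proof.
by congr Num.sqrt; apply: eq_bigr => i _; apply: eq_bigr => j _; rewrite expr2.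
Qed.

Lemma frob_norm_sqr m n (A : 'M[R]_(m, n)) : frob_norm A ^+ 2 = frob_dot A A.
Proof. by rewrite frob_normE sqr_sqrtr ?frob_dot_ge0. Qed.

Lemma frob_norm_ge0 m n (A : 'M[R]_(m, n)) : 0 <= frob_norm A.
Proof. exact: sqrtr_ge0. Qed.

Lemma frob_normZ m n a (A : 'M[R]_(m, n)) :
  0 <= a -> frob_norm (a *: A) = a * frob_norm A.
Proof.
move=> a0; apply/eqP; rewrite -(@eqrXn2 _ 2) ?mulr_ge0 ?frob_norm_ge0 //.
rewrite exprMn !frob_norm_sqr frob_dotZl frob_dotC frob_dotZl.
by rewrite mulrA expr2.
Qed.

Lemma frob_normN m n (A : 'M[R]_(m, n)) : frob_norm (- A) = frob_norm A.
Proof.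
by congr Num.sqrt; apply: eq_bigr => i _; apply: eq_bigr => j _;
  rewrite mxE sqrrN.
Qed.

(** Cyclicity of the trace brings [P] next to [P^T] and [Q] next to [Q^T]. Only the rows need be
    orthonormal, so this serves both changes of orthonormal basis and zero-padding of a block. *)
Lemma frob_dot_isometry m n m' n' (P : 'M[R]_(m', m)) (Q : 'M[R]_(n', n))
    (A : 'M[R]_(m', n')) : P *m P^T = 1%:M -> Q *m Q^T = 1%:M ->
  frob_dot (P^T *m A *m Q) (P^T *m A *m Q) = frob_dot A A.
Proof.
move=> PP QQ; rewrite !frob_dotE !trmx_mul trmxK -!mulmxA mxtrace_mulC.
rewrite !mulmxA -[A *m Q *m Q^T]mulmxA QQ mulmx1.
by rewrite -!mulmxA PP mulmx1.
Qed.

(** Transposing inside the trace and then permuting cyclically turns the product into its own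
    opposite. *)
Lemma frob_dot_antisym_sym n (A S : 'M[R]_n) :
  A^T = - A -> S^T = S -> frob_dot A S = 0.
Proof.
move=> AT ST; have : frob_dot A S = - frob_dot A S.
  rewrite !frob_dotE ST -[LHS]mxtrace_tr trmx_mul AT ST mulmxN raddfN /=.
  by rewrite mxtrace_mulC.
by move/eqP; rewrite -addr_eq0 -mulr2n mulrn_eq0 /= => /eqP.
Qed.

Lemma diag_le_frob_dot n (A : 'M[R]_n) : \sum_i A i i ^+ 2 <= frob_dot A A.
Proof.
apply: ler_sum => i _; rewrite (bigD1 i) //= -expr2 lerDl.
by apply: sumr_ge0 => j _; rewrite -expr2 sqr_ge0.
Qed.

Lemma frob_dot_diag n (d : 'rV[R]_n) :
  frob_dot (diag_mx d) (diag_mx d) = \sum_i d 0 i ^+ 2.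
Proof.
apply: eq_bigr => i _; rewrite (bigD1 i) //= big1 => [|j /negPf ji].
  by rewrite addr0 mxE eqxx mulr1n -expr2.
by rewrite mxE eq_sym ji mulr0n mul0r.
Qed.

Lemma rowsub1_mulT m n (f : 'I_m -> 'I_n) : injective f ->
  rowsub f 1%:M *m (rowsub f 1%:M)^T = 1%:M :> 'M[R]_m.
Proof.
move=> f_inj; rewrite trmx_mxsub trmx1 -mxsub_mul mulmx1.
by apply/matrixP => i j; rewrite !mxE (inj_eq f_inj).
Qed.

Lemma mxsub_rowsub1E m n m' n' (f : 'I_m' -> 'I_m) (g : 'I_n' -> 'I_n)
    (A : 'M[R]_(m, n)) :
  mxsub f g A = rowsub f 1%:M *m A *m (rowsub g 1%:M)^T.
Proof. by rewrite trmx_mxsub trmx1 mulmx_colsub mulmx1 -rowsubE -mxsub_comp. Qed.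

Lemma mxsubB m n m' n' (f : 'I_m' -> 'I_m) (g : 'I_n' -> 'I_n)
    (A B : 'M[R]_(m, n)) : mxsub f g (A - B) = mxsub f g A - mxsub f g B.
Proof. by apply/matrixP => i j; rewrite !mxE. Qed.

(* [P^T *m (P *m A *m Q^T) *m Q], [P] and [Q] the row selections of [f] and [g],
   is the orthogonal projection of [A], so the difference has norm at least 0. *)
Lemma frob_dot_mxsub m n m' n' (f : 'I_m' -> 'I_m) (g : 'I_n' -> 'I_n)
    (A : 'M[R]_(m, n)) : injective f -> injective g ->
  frob_dot (mxsub f g A) (mxsub f g A) <= frob_dot A A.
Proof.
move=> /rowsub1_mulT PP /rowsub1_mulT QQ; rewrite mxsub_rowsub1E.
set P := rowsub f _ in PP *; set Q := rowsub g _ in QQ *.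
set S := P *m A *m Q^T; have := frob_dot_ge0 (- (P^T *m S *m Q) + A).
rewrite frob_dotDD -!scaleN1r frob_dotZl [frob_dot _ (_ *: _)]frob_dotC.
(* The cross term also equals [frob_dot S S], since under the trace [P] and [Q^T] move onto [A] and
   turn it into [S]; the expansion collapses to [frob_dot A A - frob_dot S S]. *)
rewrite !frob_dotZl frob_dot_isometry // [frob_dot _ A](_ : _ = frob_dot S S).
  rewrite !mulN1r opprK mulrN mulrDl mul1r opprD addrA subrr add0r.
  by rewrite addrC subr_ge0.
rewrite frob_dotE -!mulmxA mxtrace_mulC -!mulmxA frob_dotE.
by rewrite [in RHS]/S !trmx_mul trmxK !mulmxA.
Qed.

End Frobenius.

(** * Positive semidefinite matrices and negative parts *)

Section Semidefinite.
Variable R : realType.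

Lemma possemidef_congr m n (M : 'M[R]_(n, m)) (A : 'M[R]_n) :
  possemidef A -> possemidef (M^T *m A *m M).
Proof.
move=> [AT A0]; split; first by rewrite !trmx_mul trmxK AT mulmxA.
by move=> v; have := A0 (M *m v); rewrite trmx_mul !mulmxA.
Qed.

Lemma possemidef_mxsub m n (f : 'I_m -> 'I_n) (A : 'M[R]_n) :
  possemidef A -> possemidef (mxsub f f A).
Proof. by rewrite mxsub_rowsub1E -{1}[rowsub f _]trmxK; apply: possemidef_congr. Qed.

Lemma possemidef_diag_ge0 n (A : 'M[R]_n) i : possemidef A -> 0 <= A i i.
Proof.
move=> [_ /(_ (delta_mx i 0))].
by rewrite trmx_delta -rowE -colE !mxE.
Qed.

Lemma possemidef_diag_mx n (d : 'rV[R]_n) :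
  (forall i, 0 <= d 0 i) -> possemidef (diag_mx d).
Proof.
move=> d0; split=> [|v]; first by rewrite tr_diag_mx.
rewrite mul_mx_diag mxE; apply: sumr_ge0 => i _.
by rewrite !mxE mulrAC -expr2 mulr_ge0 ?sqr_ge0.
Qed.

(** For symmetric invertible [A], the inverse is the congruence of [A] by [invmx A]. *)
Lemma possemidef_invmx n (A : 'M[R]_n) :
  A \in unitmx -> possemidef A -> possemidef (invmx A).
Proof.
move=> Au Apsd; have [AT _] := Apsd.
have := possemidef_congr (invmx A) Apsd.
by rewrite trmx_inv AT mulVmx // mul1mx.
Qed.

Lemma possemidef_orthodiag n (V : 'M[R]_n) (d : 'rV[R]_n) :
  V *m V^T = 1%:M ->
  possemidef (V^T *m diag_mx d *m V) <-> forall i, 0 <= d 0 i.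
Proof.
move=> VV; split=> [psd i | d0]; last first.
  exact/possemidef_congr/possemidef_diag_mx.
have := possemidef_diag_ge0 i (possemidef_congr V^T psd).
by rewrite trmxK !mulmxA VV mul1mx -mulmxA VV mulmx1 mxE eqxx mulr1n.
Qed.

(** Rotating by [V] turns the difference into [diag_mx d - Z] with [Z] having nonnegative diagonal.
    Keeping only the diagonal can only decrease the norm, and where [d 0 i <= 0 <= Z i i] the entry
    is at least as large in absolute value as [d 0 i]. *)
Lemma negative_part_minimal n (V Y : 'M[R]_n) (d : 'rV[R]_n) :
  V *m V^T = 1%:M -> possemidef Y ->
  \sum_i Num.min (d 0 i) 0 ^+ 2
    <= frob_dot (V^T *m diag_mx d *m V - Y) (V^T *m diag_mx d *m V - Y).
Proof.
move=> VV Ypsd; have V'V := mulmx1C VV.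
set Z := V *m Y *m V^T.
have Z0 i : 0 <= Z i i.
  apply: possemidef_diag_ge0; rewrite /Z -{1}[V]trmxK.
  exact: possemidef_congr.
have -> : V^T *m diag_mx d *m V - Y = V^T *m (diag_mx d - Z) *m V.
  rewrite mulmxBr mulmxBl; congr (_ - _).
  by rewrite /Z !mulmxA V'V mul1mx -mulmxA V'V mulmx1.
clearbody Z; rewrite frob_dot_isometry //; apply: le_trans (diag_le_frob_dot _).
apply: ler_sum => i _; rewrite !mxE eqxx mulr1n.
have [di0|di0] := leP (d 0 i) 0; last by rewrite expr0n sqr_ge0.
rewrite -[leRHS]sqrrN -[leLHS]sqrrN opprB lerXn2r ?nnegrE ?oppr_ge0 //.
  by rewrite subr_ge0 (le_trans di0).
by rewrite lerDr.
Qed.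

(** The transition matrix [U] between the two eigenbases intertwines [d] and [e], so [U i j] can be
    nonzero only when [d 0 i = e 0 j]. Hence [U] also intertwines the images of [d] and [e] under
    any function, here the minimum with 0. *)
Lemma negative_part_unique n (A N N' : 'M[R]_n) :
  negative_part A N -> negative_part A N' -> N = N'.
Proof.
move=> [V [d [VV AE ->]]] [W [e [WW AE' ->]]].
have V'V := mulmx1C VV; have W'W := mulmx1C WW.
have [U UE] : exists U, U = V *m W^T by exists (V *m W^T).
have dU : diag_mx d *m U = U *m diag_mx e.
  rewrite UE; transitivity (V *m A *m W^T).
    by rewrite AE !mulmxA VV mul1mx.
  by rewrite AE' !mulmxA -[_ *m W *m W^T]mulmxA WW mulmx1.
have dU' : diag_mx (map_mx (fun x => Num.min x 0) d) *m U =
           U *m diag_mx (map_mx (fun x => Num.min x 0) e).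
  apply/matrixP => i j; have := congr1 (fun M : 'M_n => M i j) dU.
  rewrite /= !mul_diag_mx !mul_mx_diag !mxE.
  have [->|U0] := eqVneq (U i j) 0; first by rewrite !mulr0 !mul0r.
  by rewrite mulrC => /(mulfI U0) ->; rewrite mulrC.
have -> : V^T *m diag_mx (map_mx (fun x => Num.min x 0) d) *m V =
          V^T *m (diag_mx (map_mx (fun x => Num.min x 0) d) *m U) *m W.
  by rewrite UE -!mulmxA W'W mulmx1.
by rewrite dU' UE !mulmxA V'V mul1mx.
Qed.

End Semidefinite.

(** * Spectral theorem for real symmetric matrices *)

Section Spectral.
Variable R : realType.

Lemma dot_row_eq0 n (w : 'rV[R]_n) : (w *m w^T) 0 0 = 0 -> w = 0.
Proof.
move=> w0; apply: frob_dot_eq0.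
by rewrite frob_dotE /mxtrace big_ord_recl big_ord0 addr0.
Qed.

Lemma householder n (u : 'rV[R]_n.+1) : u *m u^T = 1%:M ->
  exists H : 'M[R]_n.+1, H *m H^T = 1%:M /\ row 0 H = u.
Proof.
move=> uu; pose e : 'rV[R]_n.+1 := delta_mx 0 0.
(* [H] below is the reflection exchanging [e] and [u]; it degenerates when
   [u = e]. *)
have [w wE] : exists w, w = u - e by exists (u - e).
pose c := (w *m w^T) 0 0.
have wwE : w *m w^T = c%:M by rewrite [LHS]mx11_scalar.
have ee : e *m e^T = 1%:M.
  by rewrite trmx_delta mul_delta_mx; apply/matrixP => i j; rewrite !mxE !ord1.
(* As [u] and [e] are unit vectors, the squared length of [u - e] is [2 - 2 * u 0 0]. This makes the
   reflection subtract exactly [- w] from [e]. *)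
have cE : c = - 2 * w 0 0.
  have ue : (u *m e^T) 0 0 = u 0 0 by rewrite trmx_delta -colE mxE.
  have eu : (e *m u^T) 0 0 = u 0 0 by rewrite -rowE !mxE.
  have dB (X Y : 'M[R]_1) : (X - Y) 0 0 = X 0 0 - Y 0 0 by rewrite !mxE.
  rewrite /c wE raddfB /= mulmxBl !mulmxBr uu ee !dB ue eu !mxE eqxx.
  ring.
have [c0|c0] := eqVneq c 0.
  exists 1%:M; rewrite trmx1 mulmx1; split=> //.
  rewrite row1 -/e; apply/esym/eqP; rewrite -subr_eq0 -wE.
  exact/eqP/dot_row_eq0.
clearbody c.
pose H := 1%:M - (2 / c) *: (w^T *m w).
exists H; split.
  have -> : H^T = H.
    by rewrite /H linearB linearZ /= trmx1 trmx_mul trmxK.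
  rewrite /H mulmxBl mul1mx mulmxBr mulmx1 -scalemxAl -scalemxAr !mulmxA.
  rewrite -[w^T *m w *m w^T]mulmxA wwE mul_mx_scalar -!scalemxAl !scalerA.
  rewrite divfK // -addrA -opprD -scalerBl -scalerDl.
  by rewrite (_ : 2 / c + _ = 0) ?scale0r ?subr0 //; ring.
rewrite rowE mulmxBr mulmx1 -/e -scalemxAr mulmxA.
have -> : e *m w^T = (w 0 0)%:M.
  by rewrite [LHS]mx11_scalar -rowE !mxE.
rewrite mul_scalar_mx scalerA.
have -> : 2 / c * w 0 0 = - 1.
  apply: (mulIf c0); rewrite mulrAC divfK // cE.
  ring.
by rewrite scaleN1r opprK wE addrC subrK.
Qed.

(** The scalar matrix of the indeterminate commutes with [P], so the whole characteristic matrix is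
    conjugated and its determinant is unchanged. *)
Lemma char_poly_conj n (P A Q : 'M[R]_n) :
  P *m Q = 1%:M -> char_poly (P *m A *m Q) = char_poly A.
Proof.
move=> PQ; rewrite /char_poly.
have PQp : map_mx polyC P *m map_mx polyC Q = 1%:M.
  by rewrite -map_mxM PQ map_mx1.
have -> : char_poly_mx (P *m A *m Q) =
          map_mx polyC P *m char_poly_mx A *m map_mx polyC Q.
  rewrite /char_poly_mx mulmxBr mulmxBl -!map_mxM; congr (_ - _).
  by rewrite mul_mx_scalar -scalemxAl PQp scalemx1.
by rewrite !det_mulmx mulrAC -det_mulmx PQp det1 mul1r.
Qed.

(* Splitting of the characteristic polynomial provides the real eigenvalues; a
   Householder matrix with an eigenvector as first row deflates [A]. *)
Lemma real_spectral n (A : 'M[R]_n) (lambda : 'I_n -> R) :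
  A^T = A -> eigenvalues_of A lambda ->
  exists V : 'M[R]_n,
    V *m V^T = 1%:M /\ A = V^T *m diag_mx (\row_i lambda i) *m V.
Proof.
elim: n A lambda => [|n IH] A lambda AT Alam.
  by exists 1%:M; split; apply/matrixP => -[].
have : eigenvalue A (lambda 0).
  by rewrite eigenvalue_root_char Alam rootE horner_prod big_ord_recl
             hornerXsubC subrr mul0r.
case/eigenvalueP => v vA v0.
pose c := (v *m v^T) 0 0.
have c_gt0 : 0 < c.
  rewrite lt_neqAle eq_sym; apply/andP; split.
    by apply: contraNneq v0 => /dot_row_eq0 ->.
  by rewrite /c mxE; apply: sumr_ge0 => i _; rewrite mxE -expr2 sqr_ge0.
pose u := (Num.sqrt c)^-1 *: v.
have uA : u *m A = lambda 0 *: u by rewrite -scalemxAl vA !scalerA mulrC.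
have uu : u *m u^T = 1%:M.
  rewrite linearZ /= -scalemxAl -scalemxAr scalerA -invfM -expr2.
  rewrite sqr_sqrtr ?ltW // [v *m _]mx11_scalar -/c scale_scalar_mx.
  by rewrite mulVf ?gt_eqF.
have [H [HH Hu]] := householder uu.
have H'H := mulmx1C HH.
(* The dimension is written [1 + n] so that block operations can split off the first row and
   column. *)
have [M MH] : exists M : 'M_(1 + n), M = H *m A *m H^T.
  by exists (H *m A *m H^T).
have MT : M^T = M by rewrite MH !trmx_mul trmxK AT mulmxA.
(* The first row of [H] is the left eigenvector [u], and [u *m H^T] is the first basis vector.
   Symmetry of [M] then clears the first column as well. *)
have M0 : row 0 M = lambda 0 *: delta_mx 0 0.
  by rewrite MH !row_mul Hu uA -Hu -scalemxAl -row_mul HH row1.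
have M0j j : M 0 j = lambda 0 *+ (j == 0).
  by have := congr1 (fun N : 'rV_n.+1 => N 0 j) M0; rewrite !mxE eqxx /= mulr_natr.
have Mj0 j : M j 0 = lambda 0 *+ (j == 0) by rewrite -M0j -{1}MT mxE.
have ME : M = block_mx (lambda 0)%:M 0 0 (drsubmx M).
  rewrite -[LHS]submxK; congr block_mx; apply/matrixP => i j; rewrite !ord1 !mxE.
  - have -> : lshift n (0 : 'I_1) = 0 :> 'I_n.+1 by apply: val_inj.
    by rewrite M0j eqxx.
  - have -> : lshift n (0 : 'I_1) = 0 :> 'I_n.+1 by apply: val_inj.
    by rewrite M0j.
  - have -> : lshift n (0 : 'I_1) = 0 :> 'I_n.+1 by apply: val_inj.
    by rewrite Mj0.
have D_T : (drsubmx M)^T = drsubmx M by rewrite trmx_drsub MT.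
(* The characteristic polynomial of the block-diagonal [M] is that of [A]; cancelling the factor of
   [lambda 0] leaves the remaining eigenvalues, with multiplicity and in order. *)
have D_lam : eigenvalues_of (drsubmx M) (fun i => lambda (lift 0 i)).
  have : char_poly M = char_poly A by rewrite MH; apply: char_poly_conj.
  rewrite Alam {1}ME /char_poly char_block_diag_mx det_ublock big_ord_recl.
  have -> : \det (char_poly_mx (lambda 0)%:M : 'M_1) = 'X - (lambda 0)%:P.
    by rewrite det_mx11 !mxE eqxx !mulr1n.
  by move/(mulfI (negbT (polyXsubC_eq0 _))).
have [W [WW DE]] := IH _ _ D_T D_lam.
pose U : 'M_(1 + n) := block_mx 1%:M 0 0 W.
have UT : U^T = block_mx 1%:M 0 0 W^T by rewrite tr_block_mx !trmx0 trmx1.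
pose mu : 'rV[R]_n := \row_i lambda (lift 0 i).
have rowE : \row_i lambda i = row_mx (lambda 0)%:M mu :> 'rV_(1 + n).
  apply/rowP => i; rewrite !mxE; case: splitP => j ij; rewrite ?ord1 !mxE.
    by rewrite mulr1n; congr lambda; apply: val_inj; rewrite /= ij ord1.
  by congr lambda; apply: val_inj; rewrite /= ij.
have ME' : M = U^T *m diag_mx (row_mx (lambda 0)%:M mu) *m U.
  have -> : diag_mx (row_mx (lambda 0)%:M mu) =
            block_mx (lambda 0)%:M 0 0 (diag_mx mu) :> 'M_(1 + n).
    rewrite diag_mx_row; congr block_mx.
    by apply/matrixP => i j; rewrite !ord1 !mxE.
  rewrite {1}ME UT /U !mulmx_block.
  rewrite !(mul0mx, mulmx0, addr0, add0r, mul1mx, mulmx1).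
  by rewrite -DE.
have UU : U *m U^T = 1%:M.
  rewrite UT /U mulmx_block !(mul0mx, mulmx0, addr0, add0r, mul1mx) WW.
  by rewrite -scalar_mx_block.
exists (U *m H); split.
  by rewrite trmx_mul mulmxA -[U *m H *m _]mulmxA HH mulmx1 UU.
rewrite rowE trmx_mul !mulmxA -!(mulmxA H^T) -ME'.
by rewrite MH !mulmxA H'H mul1mx -mulmxA H'H mulmx1.
Qed.

End Spectral.

(** * Semidefiniteness of the stiffness matrix and of response blocks *)

Section Response.
Variable R : realType.

Lemma possemidefD n (A B : 'M[R]_n) :
  possemidef A -> possemidef B -> possemidef (A + B).
Proof.
move=> [AT A0] [BT B0]; split=> [|v]; first by rewrite linearD /= AT BT.
by rewrite mulmxDr mulmxDl mxE addr_ge0.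
Qed.

Lemma possemidef_stiffness (G : network R) (k : 'I_(nbonds G) -> R) :
  (forall b, 0 < k b) -> possemidef (stiffness_mx k).
Proof.
move=> k0; apply: (big_ind (@possemidef R _)) => [||b _].
- by split=> [|v]; rewrite ?trmx0 // mulmx0 mul0mx mxE.
- exact: possemidefD.
(* Each bond term is a congruence of the 1 by 1 matrix [k b]. *)
have -> : k b *: (bond_vec b *m (bond_vec b)^T) =
          (bond_vec b)^T^T *m (k b)%:M *m (bond_vec b)^T.
  by rewrite trmxK mul_mx_scalar scalemxAl.
by apply: possemidef_congr; rewrite -diag_const_mx;
  apply: possemidef_diag_mx => i; rewrite mxE ltW.
Qed.

Lemma response_psd_overlap (G : network R) (mT mS p : nat)
    (tau : 'I_p -> 'I_mT) (sigma : 'I_p -> 'I_mS)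
    (t : 'I_mT -> 'I_(nfree G)) (s : 'I_mS -> 'I_(nfree G))
    (k : 'I_(nbonds G) -> R) :
  overlap tau sigma t s -> admissible k ->
  psd_overlap tau sigma (response t s k).
Proof.
move=> [ts _] [k0 ku]; rewrite /psd_overlap /=.
(* On the overlap, [t] after [tau] and [s] after [sigma] select the same degrees of freedom, so the
   block is a principal submatrix. *)
have -> : mxsub tau sigma (response t s k) =
          mxsub (t \o tau) (t \o tau) (compliance k).
  by apply/matrixP => i j; rewrite !mxE /= !ts.
apply: possemidef_mxsub; apply: possemidef_invmx ku _.
exact/possemidef_mxsub/possemidef_stiffness.
Qed.

End Response.

(** * Distance to the matrices with semidefinite overlap block *)

Section Distance.
Variable R : realType.

Lemma frob_dist_le m n (A X : 'M[R]_(m, n)) E :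
  E X -> frob_dist A E <= frob_norm (A - X).
Proof.
move=> EX; apply: ge_inf; last by exists X.
by exists 0 => _ [Y _ <-]; apply: frob_norm_ge0.
Qed.

(** The minimiser [X] also witnesses that [E] is nonempty, which keeps [inf] away from its default
    value. *)
Lemma frob_dist_attained m n (A X : 'M[R]_(m, n)) E :
  E X -> (forall Y, E Y -> frob_norm (A - X) <= frob_norm (A - Y)) ->
  frob_dist A E = frob_norm (A - X).
Proof.
move=> EX Xmin; apply/le_anti; rewrite frob_dist_le //=.
apply: lb_le_inf; first by exists (frob_norm (A - X)), X.
by move=> _ [Y EY <-]; apply: Xmin.
Qed.

Lemma trmx_sym_part n (B : 'M[R]_n) :
  (2^-1 *: (B + B^T))^T = 2^-1 *: (B + B^T).
Proof. by rewrite linearZ linearD /= trmxK addrC. Qed.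

Lemma trmx_antisym_part n (B : 'M[R]_n) :
  (2^-1 *: (B - B^T))^T = - (2^-1 *: (B - B^T)).
Proof. by rewrite linearZ linearB /= trmxK -scalerN opprB. Qed.

(** Pythagoras for [B - Y = Ba + (Bs - Y)], an antisymmetric plus a symmetric matrix. *)
Lemma frob_dot_sub_sym n (B Y : 'M[R]_n) : Y^T = Y ->
  let Ba := 2^-1 *: (B - B^T) in let Bs := 2^-1 *: (B + B^T) in
  frob_dot (B - Y) (B - Y) = frob_dot Ba Ba + frob_dot (Bs - Y) (Bs - Y).
Proof.
move=> YT Ba Bs; have -> : B - Y = Ba + (Bs - Y).
  rewrite addrA; congr (_ - _); rewrite -scalerDr [B + B^T]addrC.
  rewrite addrA subrK -mulr2n.
  by rewrite -scaler_nat scalerA mulVf ?scale1r ?pnatr_eq0.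
rewrite frob_dotDD [frob_dot Ba (Bs - Y)]frob_dot_antisym_sym ?mulr0 ?addr0 //.
  exact: trmx_antisym_part.
by rewrite linearB /= trmx_sym_part YT.
Qed.

Lemma frob_dist_psd_overlap (mT mS p : nat) (tau : 'I_p -> 'I_mT)
    (sigma : 'I_p -> 'I_mS) (A : 'M[R]_(mT, mS)) (V : 'M[R]_p) (d : 'rV[R]_p) :
  injective tau -> injective sigma -> V *m V^T = 1%:M ->
  let B := mxsub tau sigma A in
  2^-1 *: (B + B^T) = V^T *m diag_mx d *m V ->
  frob_dist A (psd_overlap tau sigma) =
  Num.sqrt (frob_dot (2^-1 *: (B - B^T)) (2^-1 *: (B - B^T))
            + \sum_i Num.min (d 0 i) 0 ^+ 2).
Proof.
move=> tau_inj sigma_inj VV B BsE.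
have PP := rowsub1_mulT R tau_inj; have QQ := rowsub1_mulT R sigma_inj.
pose dplus : 'rV[R]_p := map_mx (fun x => Num.max x 0) d.
pose Y := V^T *m diag_mx dplus *m V.
have Ypsd : possemidef Y.
  by apply/possemidef_orthodiag => // i; rewrite mxE le_max lexx orbT.
have [YT _] := Ypsd.
(* The candidate minimiser: the overlap block of [A] is replaced by [Y], the positive part of the
   symmetric part of [B], and every other entry is kept. *)
pose X := A - (rowsub tau 1%:M)^T *m (B - Y) *m rowsub sigma 1%:M.
have XY : mxsub tau sigma X = Y.
  rewrite /X mxsubB -/B mxsub_rowsub1E !mulmxA PP mul1mx -mulmxA QQ mulmx1.
  by rewrite opprB addrC subrK.
have normX : frob_norm (A - X) =
    Num.sqrt (frob_dot (2^-1 *: (B - B^T)) (2^-1 *: (B - B^T))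
              + \sum_i Num.min (d 0 i) 0 ^+ 2).
  rewrite /X opprB addrC subrK frob_normE frob_dot_isometry //.
  rewrite frob_dot_sub_sym // BsE /Y -mulmxBl -mulmxBr -raddfB /=.
  rewrite frob_dot_isometry // frob_dot_diag; congr (Num.sqrt (_ + _)).
  apply: eq_bigr => i _; congr (_ ^+ 2); rewrite !mxE.
  by have [_|_] := leP (d 0 i) 0; rewrite ?subr0 ?subrr.
rewrite -normX; apply: frob_dist_attained; first by rewrite /psd_overlap /= XY.
move=> Z; rewrite /psd_overlap /= => Zpsd; rewrite normX frob_normE.
(* For any competitor [Z], passing to the overlap block loses norm; there the antisymmetric part is
   a fixed cost and the symmetric part costs at least the squared negative eigenvalues. *)
apply: ler_wsqrtr; apply: le_trans (frob_dot_mxsub _ tau_inj sigma_inj).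
by rewrite mxsubB -/B (frob_dot_sub_sym _ Zpsd.1) lerD2l BsE; apply: negative_part_minimal.
Qed.

End Distance.

(** * The lower bound, its closed form and the case of equality *)

Theorem theorem3 (R : realType) (mT mS p : nat)
    (tau : 'I_p -> 'I_mT) (sigma : 'I_p -> 'I_mS)
    (tau_inj : injective tau) (sigma_inj : injective sigma)
    (Rstar : 'M[R]_(mT, mS)) (lambda : 'I_p -> R) :
  let B : 'M[R]_p := mxsub tau sigma Rstar in
  let Ba := 2^-1 *: (B - B^T) in
  let Bs := 2^-1 *: (B + B^T) in
  let bound := frob_dist Rstar (psd_overlap tau sigma) in
  eigenvalues_of Bs lambda ->
  [/\ forall G : network R, passive G ->
        forall (t : 'I_mT -> 'I_(nfree G)) (s : 'I_mS -> 'I_(nfree G)),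
        injective t -> injective s -> overlap tau sigma t s ->
        forall k : 'I_(nbonds G) -> R, admissible k ->
        bound <= frob_norm (response t s k - Rstar),
      bound = Num.sqrt (4^-1 * frob_norm (B - B^T) ^+ 2
                        + \sum_(i < p) Num.min (lambda i) 0 ^+ 2),
      exists N : 'M[R]_p,
        [/\ unique (negative_part Bs) N,
            4^-1 * frob_norm (B - B^T) ^+ 2 = frob_norm Ba ^+ 2,
            \sum_(i < p) Num.min (lambda i) 0 ^+ 2 = frob_norm N ^+ 2
          & frob_dot Ba N = 0],
      \sum_(i < p) Num.min (lambda i) 0 ^+ 2 = 0 <-> possemidef Bs
    & (possemidef Bs -> bound = 2^-1 * frob_norm (B - B^T)) /\
      (~ possemidef Bs -> 2^-1 * frob_norm (B - B^T) < bound)].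
Proof.
move=> B Ba Bs bound Blam.
have [V [VV BsE]] := real_spectral (trmx_sym_part B) Blam.
have boundE := frob_dist_psd_overlap tau_inj sigma_inj VV BsE.
have normBa : 4^-1 * frob_norm (B - B^T) ^+ 2 = frob_dot Ba Ba.
  rewrite frob_norm_sqr frob_dotZl frob_dotC frob_dotZl mulrA.
  by congr (_ * _); rewrite -invfM -natrM.
have sumE : \sum_i Num.min ((\row_i lambda i) 0 i) 0 ^+ 2
            = \sum_(i < p) Num.min (lambda i) 0 ^+ 2.
  by apply: eq_bigr => i _; rewrite mxE.
rewrite sumE -normBa -/bound in boundE.
have sum_ge0 : 0 <= \sum_(i < p) Num.min (lambda i) 0 ^+ 2.
  by apply: sumr_ge0 => i _; apply: sqr_ge0.
have psdP : \sum_(i < p) Num.min (lambda i) 0 ^+ 2 = 0 <-> possemidef Bs.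
  rewrite /Bs BsE possemidef_orthodiag //; split=> [/eqP|lam0].
    rewrite psumr_eq0 => [/allP s0 i|i _]; last exact: sqr_ge0.
    have := s0 i (mem_index_enum i); rewrite mxE /= sqrf_eq0.
    by move/eqP/min_idPr.
  apply: big1 => i _; have := lam0 i; rewrite mxE => /min_idPr ->.
  by rewrite expr0n.
have halfE : 2^-1 * frob_norm (B - B^T) =
             Num.sqrt (4^-1 * frob_norm (B - B^T) ^+ 2).
  by rewrite normBa -frob_normE /Ba frob_normZ ?invr_ge0.
split=> //.
- move=> G _ t s _ _ ts k k_adm.
  rewrite -opprB frob_normN; apply: frob_dist_le.
  exact: response_psd_overlap.
(* In the eigenbasis already found, the squared norm of the negative part is the sum over the
   clipped eigenvalues; [N] is symmetric, hence orthogonal to [Ba]. *)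
- pose N := V^T *m diag_mx (map_mx (fun x => Num.min x 0) (\row_i lambda i)) *m V.
  have Nneg : negative_part Bs N by exists V, (\row_i lambda i).
  exists N; split.
  + by split=> // N'; apply: negative_part_unique.
  + by rewrite normBa frob_norm_sqr.
  + rewrite frob_norm_sqr frob_dot_isometry // frob_dot_diag -sumE.
    by apply: eq_bigr => i _; rewrite !mxE.
  + apply: frob_dot_antisym_sym; first exact: trmx_antisym_part.
    by rewrite !trmx_mul trmxK tr_diag_mx mulmxA.
- split=> [/psdP s0|npsd]; first by rewrite boundE s0 addr0 halfE.
  (* Strict monotonicity of the square root also asks that the larger argument be positive. Both
     goals reduce to the eigenvalue sum being nonzero, which [psdP] gives. *)
  rewrite boundE halfE ltr_sqrt.
    rewrite ltrDl lt_neqAle sum_ge0 andbT eq_sym.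
    by apply/eqP => /psdP.
  rewrite ltr_wpDl ?normBa ?frob_dot_ge0 // lt_neqAle sum_ge0 andbT eq_sym.
  by apply/eqP => /psdP.
Qed.
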